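(* Let $\lambda$ be an infinite cardinal that is $\omega$-inaccessible, i.e. $\mu^\omega < \lambda$ for every cardinal $\mu < \lambda$. Then there exists a family $\mathcal{A} \subset [\lambda]^{<\lambda}$ that is good over $\lambda$.
   Context: Cardinals are von Neumann ordinals, so each ordinal $\alpha<\lambda$ is the set of smaller ordinals (a proper initial segment of $\lambda$). $[\lambda]^{<\lambda}$ denotes the family of subsets of $\lambda$ of cardinality less than $\lambda$, and $[S]^{\omega_1}$ the family of subsets of $S$ of cardinality $\omega_1$. A family $\mathcal{A}$ of proper subsets of $\lambda$ is called good over $\lambda$ if: (i) $\lambda \subset \mathcal{A}$, i.e. every ordinal $\alpha<\lambda$ (every proper initial segment of $\lambda$) belongs to $\mathcal{A}$; (ii) for every $S \subset \lambda$ with $|S|<\lambda$ there is $A\in\mathcal{A}$ with $S\subset A$; (iii) for every $S\subset\lambda$ with $|S|=\omega_1$ there is $T\in[S]^{\omega_1}$ such that for every $A\in\mathcal{A}$ either $|A\cap T|\le\omega$ or $T\subset A$. *)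

(* Defs.v *)
From mathcomp Require Import all_boot all_order.
From mathcomp Require Import boolp wochoice classical_sets functions cardinality.

Set Implicit Arguments.
Unset Strict Implicit.
Unset Printing Implicit Defensive.

Local Open Scope classical_set_scope.
Local Open Scope card_scope.

Definition card_lt T U (A : set T) (B : set U) : bool := (A #<= B) && (A #!= B).

Notation "A '#<' B" := (card_lt A B) (at level 79) : card_scope.

(* An ordinal is represented by a well-ordered type: its elements are the
   smaller ordinals, and [seg a] is the ordinal [a] viewed as a subset. *)
Definition seg d (L : orderType d) (a : L) : set L := [set b | (b < a)%O].

(* Meant for an initial segment W, i.e. [set: L] or some [seg a]: the ordinal W
   is a cardinal when each smaller ordinal has strictly smaller cardinality. *)
Definition initial_ordinal d (L : orderType d) (W : set L) : Prop :=
  forall a, W a -> seg a #< W.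

Definition infinite_cardinal d (L : orderType d) : Prop :=
  [/\ well_order (<=%O : rel L),
      initial_ordinal [set: L] &
      infinite_set [set: L]].

(* The cardinals mu below L are the [mu : L] with [seg mu] an initial ordinal;
   the set of sequences below has cardinality mu^omega. *)
Definition omega_inaccessible d (L : orderType d) : Prop :=
  forall mu : L, initial_ordinal (seg mu) ->
    [set f : nat -> L | range f `<=` seg mu] #< [set: L].

(* W has the order type of the first uncountable ordinal. *)
Definition is_omega1 d (W : orderType d) : Prop :=
  [/\ well_order (<=%O : rel W),
      ~ countable [set: W] &
      forall a : W, countable (seg a)].

Definition card_omega1 T (S : set T) : Prop :=
  exists (d : Order.disp_t) (W : orderType d), is_omega1 W /\ S #= [set: W].

(* The family [L]^{<L}. *)
Definition small_subsets d (L : orderType d) : set (set L) :=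
  [set A | A #< [set: L]].

Arguments small_subsets {d} L _.

Definition good d (L : orderType d) (F : set (set L)) : Prop :=
  [/\ forall A, F A -> A `<` [set: L],
      forall a : L, F (seg a),
      forall S : set L, S #< [set: L] -> exists2 A, F A & S `<=` A &
      forall S : set L, card_omega1 S ->
        exists T : set L, [/\ T `<=` S, card_omega1 T &
          forall A, F A -> countable (A `&` T) \/ T `<=` A]].

(* Main.v *)
(* Fix a map r selecting one representative in each class of sequences in
   lambda modulo equality of tails, and let hull r A collect the terms of the
   r y for y a sequence in A.  By an infinite-exponent Jonsson argument, every
   uncountable S contains an uncountable T inside hull r Y for all uncountable
   Y in T.  Take the proper initial segments together with the sets
   A = U_n B_n of size < lambda such that hull r (B_n) is included in A: if
   A meets T in an uncountable set then so does some B_n, hence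
   T is included in hull r (B_n), thus in A.  Such sets A are cofinal because
   hull r does not enlarge a set of size mu^omega. *)
Require Import Defs.
From mathcomp Require Import all_boot all_order.
From mathcomp Require Import boolp wochoice classical_sets functions cardinality.

Local Open Scope classical_set_scope.
Local Open Scope card_scope.

Import Order.TTheory.

(** * Comparison of cardinalities *)

Lemma card_le_inj {T U} (A : set T) (B : set U) (f : T -> U) :
  (forall x, A x -> B (f x)) -> (forall x y, A x -> A y -> f x = f y -> x = y) ->
  A #<= B.
Proof.
move=> fAB fI; have /injfunPex[g] : exists2 g : T -> U, set_fun A B g & set_inj A g.
  by exists f => // x y /set_mem Ax /set_mem Ay; exact: fI.
exact: inj_card_le g.
Qed.

Lemma card_le_lt_trans {T U V} (B : set U) (A : set T) (C : set V) :
  A #<= B -> B #< C -> A #< C.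
Proof.
move=> AB /andP[BC nBC]; rewrite /card_lt (card_le_trans AB BC) /=.
apply: contra nBC; rewrite !card_eq_le BC => /andP[_ CA] /=.
exact: card_le_trans CA AB.
Qed.

Lemma card_lt_infinite {T U} (A : set T) (B : set U) :
  finite_set A -> infinite_set B -> A #< B.
Proof.
move=> finA infB; apply/andP; split; last first.
  by apply: contra_notN infB; rewrite card_eq_le => /andP[_ /card_le_finite]; apply.
apply: card_le_trans (finite_set_countable finA) _.
exact/infiniteP.
Qed.

(** * Tail equivalence of sequences and hulls *)

(** The two shifts are independent, so a sequence is equivalent to each of its own tails. *)
Definition tail_eq {T} (s t : nat -> T) : Prop :=
  exists m n, forall k, s (m + k) = t (n + k).

Lemma tail_eq_sym {T} (s t : nat -> T) : tail_eq s t -> tail_eq t s.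
Proof. by move=> [m [n st]]; exists n, m. Qed.

Lemma tail_eq_trans {T} (s t u : nat -> T) :
  tail_eq s t -> tail_eq t u -> tail_eq s u.
Proof.
move=> [m [n st]] [p [q tu]]; exists (m + p), (q + n) => k.
by rewrite -!addnA st -tu addnCA.
Qed.

Definition tail_selector {T} (r : (nat -> T) -> nat -> T) : Prop :=
  (forall s, tail_eq s (r s)) /\ (forall s t, tail_eq s t -> r s = r t).

Lemma tail_selector_exists T : exists r : (nat -> T) -> nat -> T, tail_selector r.
Proof.
have [[s0]|noseq] := pselect (inhabited (nat -> T)); last first.
  by exists id; split=> s; case: noseq; exists.
have [c cP] : {c : set (nat -> T) -> nat -> T & forall P, (exists s, P s) -> P (c P)}.
  apply: (@choice _ _ (fun P s => (exists s, P s) -> P s)) => P.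
  have [[s Ps]|nP] := pselect (exists s, P s); first by exists s.
  by exists s0 => /nP.
exists (fun s => c (tail_eq s)); split=> [s|s t st].
  by apply: cP; exists s, 0, 0.
congr (c _); apply/funext => u; apply/propext; split; last exact: tail_eq_trans.
by apply: tail_eq_trans; exact: tail_eq_sym.
Qed.

Definition hull {T} (r : (nat -> T) -> nat -> T) (A : set T) : set T :=
  [set x | exists y n, range y `<=` A /\ x = r y n].

Lemma hullS {T} (r : (nat -> T) -> nat -> T) (A B : set T) :
  A `<=` B -> hull r A `<=` hull r B.
Proof. by move=> AB x [y [n [yA ->]]]; exists y, n; split=> // z /yA /AB. Qed.

(* The Erdos-Hajnal theorem on infinite exponents, with the Galvin-Prikry
   proof: a decreasing sequence X_n of counterexamples with a_n in X_n outside
   the hull of X_(n+1) is refuted by a tail of (a_n), whose selected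
   representative eventually lists all the a_n. *)
Lemma uncountable_hull {T} (r : (nat -> T) -> nat -> T) (S : set T) :
  tail_selector r -> ~ countable S ->
  exists X : set T, [/\ X `<=` S, ~ countable X &
    forall Y, Y `<=` X -> ~ countable Y -> X `<=` hull r Y].
Proof.
move=> [rP rE] Sunc; apply: contrapT => noX.
pose Q := {X : set T | X `<=` S /\ ~ countable X}.
have next (X : Q) : exists Ya : Q * T,
    [/\ sval Ya.1 `<=` sval X, sval X Ya.2 & ~ hull r (sval Ya.1) Ya.2].
  apply: contrapT => nX; apply: noX; exists (sval X).
  case: (svalP X) => XS Xunc; split=> // Y YX Yunc a Xa; apply: contrapT => nYa.
  have YQ : Y `<=` S /\ ~ countable Y by split=> // y /YX /XS.
  by apply: nX; exists (exist _ Y YQ, a).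
have [f fP] := choice next.
pose X n := iter n (fun X => (f X).1) (exist _ S (conj (@subset_refl _ S) Sunc) : Q).
pose a n := (f (X n)).2.
have Xdecr m k : sval (X (m + k)) `<=` sval (X m).
  elim: k => [|k IH]; first by rewrite addn0.
  by apply: subset_trans IH; rewrite addnS /=; have [] := fP (X (m + k)).
have [m [n rs]] := rP a.
(* Starting at [m.+1] keeps the terms of [y] inside [X m.+1]. Its representative is still [r a],
   whose term [n] is [a m], a point chosen outside the hull of [X m.+1]. *)
pose y k := a (m.+1 + k).
have ya : r y = r a by apply: rE; exists 0, m.+1.
have [_ _] := fP (X m); apply; exists y, n; split.
  by move=> _ [k _ <-]; apply: (Xdecr m.+1 k); have [] := fP (X (m.+1 + k)).
by rewrite ya; have := rs 0; rewrite !addn0.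
Qed.

(* The distinct points p and q of V serve to write natural numbers as
   sequences in V. *)
Lemma hull_chain_card {T} (r : (nat -> T) -> nat -> T) (S V : set T) (p q : T) :
  V p -> V q -> p <> q -> S #<= V ->
  exists B : nat -> set T, [/\ S `<=` B 0, forall n, hull r (B n) `<=` B n.+1 &
    \bigcup_n B n #<= [set f : nat -> T | range f `<=` V]].
Proof.
move=> Vp Vq pq SV; pose K := [set f : nat -> T | range f `<=` V].
pose unpack (f : nat -> T) (k : nat) := fun j : nat => f (pickle (k, j)).
pose pack (G : nat -> nat -> T) i :=
  if unpickle i is Some (k, j) then G k j else G 0 0.
have packK G k : unpack (pack G) k = G k.
  by apply/funext => j; rewrite /unpack /pack pickleK.
have Kpack G : (forall k, K (G k)) -> K (pack G).
  move=> KG _ [i _ <-]; rewrite /pack; case: unpickle => [[k j]|].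
    by apply: (KG k); exists j.
  by apply: (KG 0); exists 0.
pose enc (m j : nat) := if j == m then p else q.
have Kenc m : K (enc m) by move=> _ [j _ <-]; rewrite /enc; case: eqP.
pose dec (g : nat -> T) := xget 0 [set m | g m = p].
have encK m : dec (enc m) = m.
  have : [set j | enc m j = p] (dec (enc m)).
    by apply: (@xgetI _ _ _ m); rewrite /= /enc eqxx.
  by rewrite /= /enc; case: eqP => // _ /esym.
have [i iS] : exists i : T -> T, S `<=` i @` V.
  have [->|[i]] : S = set0 \/ $|{surjfun V >-> S}| by exact/pfcard_geP.
    by exists id => x.
  by exists i; exact: surj.
(* A code in [K] for a point of level [n'.+1] is split into rows: row 0 encodes which term of the
   representative to take, and row [k.+1] is a level [n'] code for term [k] of the sequence fed to
   [r]. *)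
pose h := fix h n (f : nat -> T) : T :=
  if n is n'.+1 then r (fun k => h n' (unpack f k.+1)) (dec (unpack f 0))
  else i (f 0).
exists (fun n => h n @` K); split.
- move=> _ /iS[x Vx <-]; exists (fun=> x) => //.
  by move=> _ [j _ <-].
- move=> n _ [y [m [yB ->]]].
  have /choice[g gP] : forall k, exists f, K f /\ h n f = y k.
    by move=> k; have [f Kf <-] := yB (y k) (imageP y I); exists f.
  pose G k := if k is k'.+1 then g k' else enc m.
  exists (pack G); first by apply: Kpack => -[|k]; [exact: Kenc | have [] := gP k].
  rewrite /= packK encK; congr (r _ _); apply/funext => k.
  by rewrite packK; have [] := gP k.
(* One more packing codes the whole union: row 0 gives the level, row 1 a code at that level. *)
- pose H f := h (dec (unpack f 0)) (unpack f 1).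
  apply: card_le_trans (card_image_le H K); apply: subset_card_le.
  move=> _ [n _ [f Kf <-]].
  pose G k := if k is 0 then enc n else f.
  exists (pack G); first by apply: Kpack => -[|k] //; exact: Kenc.
  by rewrite /H !packK encK.
Qed.

(** * Well-orders and uncountable suborders *)

Lemma well_order_min {d} {L : orderType d} (P : set L) :
  well_order (<=%O : rel L) -> (exists x, P x) ->
  exists2 m, P m & forall x, P x -> (m <= x)%O.
Proof.
move=> Lwo [x Px]; have [|m [[Pm mP] _]] := Lwo [pred z | `[< P z >]].
  by exists x; apply/asboolP.
move/asboolP: Pm => Pm; exists m => // y Py.
by apply: mP; apply/asboolP.
Qed.

Lemma lt_well_founded {d} {L : orderType d} :
  well_order (<=%O : rel L) -> well_founded (fun x y : L => (x < y)%O).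
Proof.
move=> Lwo x; apply: contrapT => nx.
have [m nm mP] := @well_order_min _ _ [set z | ~ Acc (fun x y : L => (x < y)%O) z]
  Lwo (ex_intro _ x nx).
apply: nm; constructor => y ym; apply: contrapT => /mP.
by rewrite leNgt ym.
Qed.

(* Otherwise recursion along L picks distinct points of X, so L embeds in X. *)
Lemma card_lt_seg {d} {L : orderType d} {U} (X : set U) :
  well_order (<=%O : rel L) -> X #< [set: L] -> exists a : L, X #<= seg a.
Proof.
move=> Lwo /andP[XL nXL]; apply: contrapT => noa.
(* If the earlier values exhausted [X], choosing for each point a place where it is taken would
   embed [X] in [seg a]. *)
have fresh (a : L) (g : forall y, (y < a)%O -> U) :
    exists x, X x /\ forall y (ya : (y < a)%O), g y ya <> x.
  apply: contrapT => nx; apply: noa; exists a.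
  have /choice[f fP] : forall x, exists y, X x -> exists ya : (y < a)%O, g y ya = x.
    move=> x; have [[y [ya yx]]|ny] := pselect (exists y (ya : (y < a)%O), g y ya = x).
      by exists y => _; exists ya.
    exists a => Xx; case: nx; exists x; split=> // y ya yx.
    by apply: ny; exists y, ya.
  apply: (card_le_inj _ _ f) => [x /fP[]//|x y /fP[h1 gx] /fP[h2 gy] fxy].
  move: h1 gx; rewrite fxy => h1 gx; rewrite -[LHS]gx -[RHS]gy.
  by congr (g _ _); exact: bool_irrelevance.
pose F a g := proj1_sig (cid (fresh a g)).
pose G := Fix (lt_well_founded Lwo) (fun=> U) F.
have GE a : G a = F a (fun y _ => G y).
  rewrite /G Fix_eq // => x f g fg; congr (F x _).
  by apply: functional_extensionality_dep => y; apply/funext => yx.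
have GP a : X (G a) /\ forall y, (y < a)%O -> G y <> G a.
  rewrite [G a]GE /F; case: cid => x [Xx xP] /=.
  by split=> // y ya; exact: xP ya.
case/negP: nXL; rewrite card_eq_le XL /=.
apply: (card_le_inj _ _ G) => [x _|x y _ _ Gxy]; first by have [] := GP x.
have [xy|yx|//] := ltgtP x y.
- by have [_ /(_ _ xy)] := GP y.
- by have [_ /(_ _ yx) /(_ (esym Gxy))] := GP x.
Qed.

Lemma is_omega1_sub {d} {W : orderType d} (A : set W) :
  is_omega1 W -> ~ countable A -> is_omega1 (sub_type A : orderType d).
Proof.
move=> [Wwo _ Wseg] Aunc; split.
- apply: antisymmetric_well_order; first exact: le_anti.
  move=> P [x Px].
  have [m [y Py <-] mP] := @well_order_min _ _ (val @` [set` P]) Wwo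
    (ex_intro _ _ (ex_intro2 _ _ x Px erefl)).
  exists y; split=> // z Pz; rewrite leEsub.
  by apply: mP; exists z.
- by move=> cA; apply: Aunc; rewrite -(eq_countable (card_setT A)).
- move=> a; apply: sub_countable (Wseg (val a)).
  by apply: (card_le_inj _ _ val) => [x|x y _ _ /val_inj //]; rewrite /seg /= ltEsub.
Qed.

(** The image of [X] in [W] is an uncountable suborder; its proper segments inject into those of
    [W], so it has type omega_1 itself. *)
Lemma card_omega1_sub {T} (S X : set T) :
  card_omega1 S -> X `<=` S -> ~ countable X -> card_omega1 X.
Proof.
move=> [d [W [Womega SW]]] XS Xunc.
have /card_leP[f] : X #<= [set: W].
  by apply: card_le_trans (subset_card_le XS) _; move: SW; rewrite card_eq_le => /andP[].
pose A : set W := range (val \o f).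
have XA : X #= A.
  apply: card_eq_trans (card_setT_sym X) _; apply: card_esym.
  apply: inj_card_eq => x y _ _ /val_inj fxy.
  by apply: (@inj _ _ _ f) fxy; rewrite in_setT.
have Aunc : ~ countable A by move=> cA; apply: Xunc; rewrite (eq_countable XA).
exists d, (sub_type A : orderType d); split; first exact: is_omega1_sub.
exact: card_eq_trans XA (card_setT_sym A).
Qed.

Lemma card_omega1_uncountable {T} (S : set T) : card_omega1 S -> ~ countable S.
Proof. by move=> [d [W [[_ Wunc _] SW]]]; rewrite (eq_countable SW). Qed.

(** Cut [S] at the least [m] for which [seg m] meets it in an uncountable set, if there is one. *)
Lemma seg_dichotomy {d} {L : orderType d} (S : set L) :
  well_order (<=%O : rel L) -> ~ countable S ->
  exists X : set L, [/\ X `<=` S, ~ countable X &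
    forall a : L, countable (seg a `&` X) \/ X `<=` seg a].
Proof.
move=> Lwo Sunc.
have [segS|nseg] := pselect (exists a, ~ countable (seg a `&` S)); last first.
  exists S; split=> // a; left; apply: contrapT => ca.
  by apply: nseg; exists a.
have [m munc mP] := @well_order_min _ _ [set a | ~ countable (seg a `&` S)] Lwo segS.
exists (seg m `&` S); split=> // a.
have [am|ma] := ltP a m; last first.
  by right=> x [xm _]; rewrite /seg /=; exact: lt_le_trans xm ma.
left; have ca : countable (seg a `&` S).
  by apply: contrapT => /mP; rewrite leNgt am.
by apply: sub_countable ca; apply: subset_card_le => x [xa [_ Sx]].
Qed.

(** * Construction of the good family *)

Lemma hull_cover {d} {L : orderType d} (r : (nat -> L) -> nat -> L) (S : set L) :
  infinite_cardinal L -> omega_inaccessible L -> S #< [set: L] ->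
  exists B : nat -> set L, [/\ S `<=` B 0, forall n, hull r (B n) `<=` B n.+1 &
    \bigcup_n B n #< [set: L]].
Proof.
move=> [Lwo _ Linf] Linacc SL.
have [a Sa] := card_lt_seg S Lwo SL.
have [b boolb] : exists b : L, [set: bool] #<= seg b.
  by apply: card_lt_seg => //; exact: card_lt_infinite.
(* Minimality makes [seg m] a cardinal, as [omega_inaccessible] demands; room for [bool] provides
   the two points used for coding. *)
have [|m [Sm boolm] mP] :=
    @well_order_min _ _ [set c : L | S #<= seg c /\ [set: bool] #<= seg c] Lwo.
  exists (Order.max a b); split.
    apply: card_le_trans Sa _; apply: subset_card_le => x xa.
    by rewrite /seg /= lt_max xa.
  apply: card_le_trans boolb _; apply: subset_card_le => x xb.
  by rewrite /seg /= lt_max xb orbT.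
have mcard : initial_ordinal (seg m).
  move=> c cm; apply/andP; split.
    by apply: subset_card_le => x xc; exact: lt_trans xc cm.
  apply/negP; rewrite card_eq_le => /andP[_ mc].
  have := mP c (conj (card_le_trans Sm mc) (card_le_trans boolm mc)).
  by rewrite leNgt; apply/negP/negPn.
have [p [q [mp mq pq]]] : exists p q : L, [/\ seg m p, seg m q & p <> q].
  have [e eB] : exists e : L -> bool, [set: bool] `<=` e @` seg m.
    have [b0|[e]] : [set: bool] = set0 \/ $|{surjfun seg m >-> [set: bool]}|.
    - exact/pfcard_geP.
    - by have : [set: bool] true by []; rewrite b0.
    - by exists e; exact: surj.
  have [p mp ep] := eB true I; have [q mq eq] := eB false I.
  by exists p, q; split=> // pq; move: ep; rewrite pq eq.
have [B [SB BB Bcard]] := hull_chain_card r S (seg m) p q mp mq pq Sm.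
by exists B; split=> //; apply: card_le_lt_trans Bcard _; exact: Linacc.
Qed.

Theorem theorem2 (d : Order.disp_t) (L : orderType d)
    (Lcard : infinite_cardinal L) (Linacc : omega_inaccessible L) :
  exists2 F : set (set L), F `<=` small_subsets L & good F.
Proof.
have [Lwo Linit _] := Lcard.
have [r rP] := tail_selector_exists L.
(* Only sequences inside a single [B n] are considered, so a chain of length omega suffices to build
   such a set. *)
pose hulls := [set A : set L | A #< [set: L] /\
  exists B : nat -> set L, A = \bigcup_n B n /\ forall n, hull r (B n) `<=` A].
have Fsmall : range (@seg d L) `|` hulls `<=` small_subsets L.
  by move=> _ [[a _ <-]|[]//]; exact: Linit.
exists (range (@seg d L) `|` hulls) => //; split.
- move=> A /Fsmall /andP[_ AL]; split=> // LA; case/negP: AL.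
  by have -> : A = [set: L] by apply/seteqP.
- by move=> a; left; exists a.
- move=> S SL; have [B [SB BB Bsmall]] := hull_cover r S Lcard Linacc SL.
  exists (\bigcup_n B n); last by move=> x /SB; exists 0.
  by right; split=> //; exists B; split=> // n x /BB; exists n.+1.
- move=> S Somega; have Sunc := card_omega1_uncountable _ Somega.
  (* The dichotomy for segments passes from [X] to its subsets, so it survives the second thinning
     to [Y]. *)
  have [X [XS Xunc Xseg]] := seg_dichotomy S Lwo Sunc.
  have [Y [YX Yunc Yhull]] := uncountable_hull r X rP Xunc.
  have YS := subset_trans YX XS.
  exists Y; split=> //; first exact: card_omega1_sub YS Yunc.
  move=> A [[a _ <-]|[_ [B [-> BA]]]].
    have [cX|Xa] := Xseg a; last by right=> x /YX /Xa.
    by left; apply: sub_countable cX; apply: subset_card_le; exact: setIS.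
  have [cB|/existsNP[n nB]] := pselect (forall n, countable (B n `&` Y)).
    by left; rewrite setI_bigcupl; apply: bigcup_countable.
  right; apply: subset_trans (Yhull _ (@subIsetr _ _ _) nB) _.
  by apply: subset_trans (BA n); apply: hullS; exact: subIsetl.
Qed.
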